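(* Let $R$ be a commutative ring. For any filtered face set $K$, the restriction map $\widetilde C^*_{\overline\infty}(K;R)\to C^*(K^{[0]};R)$ induces an isomorphism $$H^*_{\mathrm{TW},\overline\infty}(K;R)\cong H^*(K^{[0]};R),$$ where the last term is the ordinary cohomology of the face set $K^{[0]}$.
   Context: Fix an integer $n\ge 0$. Let $\mathbf\Delta^{[n]}_{\mathcal F}$ be the category whose objects are the joins $\Delta=\Delta^{j_0}*\cdots*\Delta^{j_n}$ with $j_i\ge -1$ (conventions $\Delta^{-1}=\emptyset$, $\emptyset*X=X$; not all factors empty) and whose morphisms are joins $*_i\sigma_i$ where each $\sigma_i\colon\Delta^{j_i}\to\Delta^{k_i}$ is induced by an injective order-preserving map of vertices, or is $\emptyset\to\Delta^{k_i}$. A filtered face set is a contravariant functor $K$ from $\mathbf\Delta^{[n]}_{\mathcal F}$ to sets; its elements are simplices $\sigma\colon\Delta^{j_0}*\cdots*\Delta^{j_n}\to K$. $K_+$ denotes the simplices with $j_n\ge0$. The regular part $K^{[0]}$ is the face set (simplicial set without degeneracies) of simplices with $j_i=-1$ for all $i<n$; $C^*(K^{[0]};R)$ is its simplicial cochain complex. Thom–Whitney complex: let $C^*(\Delta^m;R)$ be the simplicial cochains of $\Delta^m$ and $c\Delta^j=\Delta^{j+1}$ the cone on $\Delta^j$, with cone point the last vertex ($c\emptyset=\Delta^0$). $\widetilde C^*(K;R)$ is the cochain complex of families $\omega=(\omega_\sigma)_{\sigma\in K_+}$, $\omega_\sigma\in C^*(c\Delta^{j_0})\otimes\cdots\otimes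 C^*(c\Delta^{j_{n-1}})\otimes C^*(\Delta^{j_n})$, with $\omega_{\sigma\circ\delta}=\delta^*\omega_\sigma$ for every morphism $\delta$ of $\mathbf\Delta^{[n]}_{\mathcal F}$ between objects with non-empty last factor. For the infinite perversity $\overline\infty$ (constant map $\infty$) there is no admissibility condition: $\widetilde C^*_{\overline\infty}(K;R)=\widetilde C^*(K;R)$, with cohomology $H^*_{\mathrm{TW},\overline\infty}(K;R)$. The restriction map sends $\omega$ to the cochain given by the $\omega_\sigma$ with $\sigma\in K^{[0]}$, using $C^*(c\emptyset;R)=R$. *)

(* Defs.v *)
From HB Require Import structures.
From mathcomp Require Import all_boot all_algebra.
From mathcomp Require Import boolp functions.
From mathcomp Require Import zify.

Set Implicit Arguments.
Unset Strict Implicit.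
Unset Printing Implicit Defensive.

Import GRing.Theory.
Local Open Scope ring_scope.
Local Open Scope quotient_scope.

(* Cochain complexes of R-modules in nonnegative degrees. *)
Record cochain_complex (R : pzRingType) := CochainComplex {
  cochains :> nat -> lmodType R;
  diff : forall k, {linear cochains k -> cochains k.+1};
  diff_diff : forall k (x : cochains k), diff k.+1 (diff k x) = 0 }.

Arguments diff {R} c k.

Record chain_map (R : pzRingType) (C D : cochain_complex R) := ChainMap {
  chain_fun :> forall k, {linear C k -> D k};
  chain_funD : forall k (x : C k),
    chain_fun k.+1 (diff C k x) = diff D k (chain_fun k x) }.

Section Cohomology.
Variables (R : pzRingType) (C : cochain_complex R) (k : nat).

Definition is_cocycle : pred (C k) := fun x => diff C k x == 0.

Fact is_cocycle_closed : submod_closed is_cocycle.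
Proof.
split=> [|a x y]; first by rewrite unfold_in /is_cocycle linear0.
rewrite !unfold_in /is_cocycle => /eqP dx /eqP dy.
by rewrite linearP dx dy scaler0 addr0.
Qed.

HB.instance Definition _ :=
  GRing.isSubmodClosed.Build R (C k) is_cocycle is_cocycle_closed.

Record cocycle := Cocycle {
  cocycle_val :> C k; cocycleP : cocycle_val \in is_cocycle }.

HB.instance Definition _ := [isSub for cocycle_val].
HB.instance Definition _ := [Choice of cocycle by <:].
HB.instance Definition _ := [SubChoice_isSubLmodule of cocycle by <:].

End Cohomology.

Definition is_coboundary (R : pzRingType) (C : cochain_complex R) (k : nat) :
    C k -> Prop :=
  match k with
  | 0 => fun x => x = 0
  | j.+1 => fun x => exists y : C j, x = diff C j y
  end.

Section CohomologyModule.
Variables (R : pzRingType) (C : cochain_complex R) (k : nat).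

Definition coboundary : pred (cocycle C k) :=
  fun z => `[< is_coboundary (cocycle_val z) >].

Lemma is_coboundaryP a (x y : C k) :
  is_coboundary x -> is_coboundary y -> is_coboundary (a *: x + y).
Proof.
case: k x y => [|j] x y /=; first by move=> -> ->; rewrite scaler0 addr0.
by move=> [x' ->] [y' ->]; exists (a *: x' + y'); rewrite linearP.
Qed.

Fact coboundary_closed : submod_closed coboundary.
Proof.
split=> [|a x y].
  by apply/asboolP; case: k => [//|j]; exists 0; rewrite linear0.
by move=> /asboolP bx /asboolP by_; apply/asboolP; exact: is_coboundaryP.
Qed.

HB.instance Definition _ :=
  GRing.isSubmodClosed.Build R (cocycle C k) coboundary coboundary_closed.

Definition cohomology : Type :=
  Quotient.quot (GRing.ZmodClosed.clone (cocycle C k) coboundary _).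

HB.instance Definition _ := GRing.Zmodule.on cohomology.
HB.instance Definition _ := EqQuotient.on cohomology.

Definition cohomology_class (z : cocycle C k) : cohomology :=
  \pi_(Quotient.quot (GRing.ZmodClosed.clone (cocycle C k) coboundary _)) z.

Lemma cohomology_classP (z t : cocycle C k) :
  cohomology_class z = cohomology_class t <->
  is_coboundary (cocycle_val z - cocycle_val t).
Proof.
split=> [/eqP|h]; last apply/eqP; rewrite -Quotient.idealrBE.
  by move=> /asboolP.
exact/asboolP.
Qed.

Lemma cohomology_class_repr (x : cohomology) : cohomology_class (repr x) = x.
Proof. exact: reprK. Qed.

Lemma cohomology_classD : {morph cohomology_class : x y / x + y}.
Proof. by move=> x y; rewrite /cohomology_class piE. Qed.

Definition cohomology_scale (a : R) (x : cohomology) : cohomology :=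
  cohomology_class (a *: repr x).

Lemma cohomology_classZ a z :
  cohomology_class (a *: z) = cohomology_scale a (cohomology_class z).
Proof.
apply/cohomology_classP.
have /cohomology_classP h := esym (cohomology_class_repr (cohomology_class z)).
rewrite /= -scalerBr -[_ *: _]addr0; apply: is_coboundaryP => //.
by case: k {z h} => [//|j]; exists 0; rewrite linear0.
Qed.

Fact cohomology_scaleA a b x :
  cohomology_scale a (cohomology_scale b x) = cohomology_scale (a * b) x.
Proof.
by rewrite -[x]cohomology_class_repr -!cohomology_classZ scalerA.
Qed.

Fact cohomology_scale1 : left_id 1 cohomology_scale.
Proof.
by move=> x; rewrite -[x]cohomology_class_repr -cohomology_classZ scale1r.
Qed.

Fact cohomology_scaleDr : right_distributive cohomology_scale +%R.
Proof.
move=> a x y; rewrite -[x]cohomology_class_repr -[y]cohomology_class_repr.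
by rewrite -cohomology_classD -!cohomology_classZ -cohomology_classD scalerDr.
Qed.

Fact cohomology_scaleDl x : {morph cohomology_scale^~ x : a b / a + b}.
Proof.
move=> a b; rewrite -[x]cohomology_class_repr.
by rewrite -!cohomology_classZ -cohomology_classD scalerDl.
Qed.

HB.instance Definition _ := GRing.Zmodule_isLmodule.Build R cohomology
  cohomology_scaleA cohomology_scale1 cohomology_scaleDr cohomology_scaleDl.

Fact cohomology_class_linear : linear cohomology_class.
Proof. by move=> a x y; rewrite cohomology_classD cohomology_classZ. Qed.

HB.instance Definition _ :=
  GRing.isLinear.Build R _ _ _ cohomology_class cohomology_class_linear.

End CohomologyModule.

Section InducedMap.
Variables (R : pzRingType) (C D : cochain_complex R) (f : chain_map C D).
Variable k : nat.

Fact cocycle_map_subproof (z : cocycle C k) :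
  f k (cocycle_val z) \in is_cocycle (C := D) (k := k).
Proof.
by rewrite unfold_in /is_cocycle -chain_funD (eqP (cocycleP z)) linear0.
Qed.

Definition cocycle_map (z : cocycle C k) : cocycle D k :=
  Cocycle (cocycle_map_subproof z).

Definition cohomology_map (x : cohomology C k) : cohomology D k :=
  cohomology_class (cocycle_map (repr x)).

Lemma is_coboundary_chain_map (x : C k) :
  is_coboundary x -> is_coboundary (f k x).
Proof.
case: k x => [|j] x /=; first by move=> ->; rewrite linear0.
by move=> [y ->]; exists (f j y); rewrite chain_funD.
Qed.

Lemma cohomology_map_class (z : cocycle C k) :
  cohomology_map (cohomology_class z) = cohomology_class (cocycle_map z).
Proof.
apply/cohomology_classP; rewrite /= -linearB.
apply: is_coboundary_chain_map.
exact/cohomology_classP/cohomology_class_repr.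
Qed.

Fact cohomology_map_linear : linear cohomology_map.
Proof.
move=> a x y; rewrite -[x]cohomology_class_repr -[y]cohomology_class_repr.
rewrite -linearP !cohomology_map_class -linearP; congr cohomology_class.
by apply: val_inj; rewrite /= linearP.
Qed.

HB.instance Definition _ :=
  GRing.isLinear.Build R _ _ _ cohomology_map cohomology_map_linear.

End InducedMap.

(* A simplex is given by its number m of vertices, so that Delta^j has
   m = j.+1 and the empty simplex Delta^{-1} has m = 0; its vertices are the
   elements of 'I_m. *)
Record face_map (m l : nat) := FaceMap {
  face_fun :> 'I_m -> 'I_l;
  face_fun_inj : injective face_fun;
  face_fun_homo : {homo face_fun : x y / (x <= y)%N} }.

Lemma face_map_eq m l (f g : face_map m l) : f =1 g -> f = g.
Proof.
case: f g => [f fi fh] [g gi gh] /= /funext fg.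
rewrite -{}fg in gi gh *.
by rewrite (Prop_irrelevance fi gi) (Prop_irrelevance fh gh).
Qed.

Definition face_id m : face_map m m :=
  @FaceMap m m id (fun x y xy => xy) (fun x y xy => xy).

Definition face_comp m l p (g : face_map l p) (f : face_map m l) :
    face_map m p :=
  @FaceMap m p (g \o f) (inj_comp (@face_fun_inj _ _ g) (@face_fun_inj _ _ f))
    (fun x y xy => face_fun_homo g (face_fun_homo f xy)).

Fact coface_homo m (i : 'I_m.+1) :
  {homo (fun j : 'I_m => lift i j) : x y / (x <= y)%N}.
Proof. by move=> x y xy; rewrite /= leq_bump2. Qed.

Definition coface m (i : 'I_m.+1) : face_map m m.+1 :=
  FaceMap (@lift_inj m.+1 i) (@coface_homo m i).

(* Adding a cone point, sent to the cone point, as a new last vertex. *)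
Definition cone_fun m l (f : 'I_m -> 'I_l) (x : 'I_m.+1) : 'I_l.+1 :=
  if unlift ord_max x is Some y then lift ord_max (f y) else ord_max.

Fact cone_fun_inj m l (f : face_map m l) : injective (cone_fun f).
Proof.
move=> x y; rewrite /cone_fun.
case: (unliftP ord_max x) => [x' ->|->]; case: (unliftP ord_max y) => [y' ->|->].
- by move/lift_inj/face_fun_inj->.
- by move/eqP; rewrite eq_sym (negPf (neq_lift _ _)).
- by move/eqP; rewrite (negPf (neq_lift _ _)).
- by [].
Qed.

Fact cone_fun_homo m l (f : face_map m l) :
  {homo cone_fun f : x y / (x <= y)%N}.
Proof.
move=> x y; rewrite /cone_fun.
case: (unliftP ord_max x) => [x' ->|->]; case: (unliftP ord_max y) => [y' ->|->].
- by rewrite !lift_max; apply: face_fun_homo.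
- by move=> _; rewrite lift_max ltnW.
- by rewrite lift_max leqNgt ltn_ord.
- by [].
Qed.

Definition cone_map m l (f : face_map m l) : face_map m.+1 l.+1 :=
  FaceMap (@cone_fun_inj m l f) (@cone_fun_homo m l f).

(* Face sets: presheaves of sets on the standard simplices Delta^k, k >= 0,
   and their injective order-preserving maps. *)
Record face_set := FaceSet {
  fsimplices :> nat -> Type;
  fpull : forall k l, face_map k.+1 l.+1 -> fsimplices l -> fsimplices k;
  fpull_id : forall k (s : fsimplices k), fpull (face_id k.+1) s = s;
  fpull_comp : forall k l p (f : face_map k.+1 l.+1) (g : face_map l.+1 p.+1)
    (s : fsimplices p), fpull (face_comp g f) s = fpull f (fpull g s) }.

Lemma antisymmetric_sum0 (V : zmodType) m (A : 'I_m -> 'I_m -> V) :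
    (forall v, A v v = 0) -> (forall v w, v != w -> A v w = - A w v) ->
  \sum_v \sum_w A v w = 0.
Proof.
move=> A0 AN.
pose L := \sum_(v < m) \sum_(w < m | (w < v)%N) A v w.
have -> : \sum_v \sum_w A v w = L + \sum_(v < m) \sum_(w < m | (v < w)%N) A v w.
  rewrite -big_split; apply: eq_bigr => v _ /=.
  rewrite (bigID (fun w : 'I_m => (w < v)%N)) /=; congr (_ + _).
  rewrite (bigD1 v) ?ltnn //= A0 add0r; apply: eq_bigl => w.
  by rewrite -leqNgt ltn_neqAle andbC eq_sym.
suff -> : \sum_(v < m) \sum_(w < m | (v < w)%N) A v w = - L by rewrite subrr.
rewrite (exchange_big_dep predT) //= -sumrN; apply: eq_bigr => w _.
rewrite -sumrN; apply: eq_bigr => v vw; apply: AN.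
by rewrite neq_ltn vw.
Qed.

Section FaceSetCochains.
Variables (R : comPzRingType) (L : face_set).

Definition fs_diff k (c : L k -> R^o) (s : L k.+1) : R^o :=
  \sum_(i < k.+2) (-1) ^+ i * c (fpull (coface i) s).

Fact fs_diff_linear k : linear (@fs_diff k).
Proof.
move=> a c c'; apply/funext => s; rewrite /fs_diff !fctE.
rewrite scaler_sumr -big_split; apply: eq_bigr => i _ /=.
by rewrite mulrDr; congr (_ + _); exact: mulrCA.
Qed.

HB.instance Definition _ k :=
  GRing.isLinear.Build R (L k -> R^o) (L k.+1 -> R^o) _ (@fs_diff k)
    (@fs_diff_linear k).

Fact fs_diff_diff k (c : L k -> R^o) : fs_diff (fs_diff c) = 0.
Proof.
apply/funext => s; rewrite /fs_diff.
pose A (v w : 'I_k.+3) : R := if unlift v w is Some j then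
  (-1) ^+ v * (-1) ^+ j * c (fpull (coface j) (fpull (coface v) s)) else 0.
transitivity (\sum_v \sum_w A v w).
  apply: eq_bigr => v _; rewrite (bigD1_ord v) //= {1}/A unlift_none add0r.
  by rewrite mulr_sumr; apply: eq_bigr => j _; rewrite /A liftK mulrA.
apply: antisymmetric_sum0 => [v|]; first by rewrite /A unlift_none.
suff AN (v w : 'I_k.+3) : (v < w)%N -> A v w = - A w v.
  by move=> v w; rewrite neq_ltn => /orP[/AN//|/AN->]; rewrite opprK.
move=> vw; rewrite /A.
have [j wE] : exists j, w = lift v j.
  by case: (unliftP v w) vw => [j ->|->]; [exists j | rewrite ltnn].
have [i vE] : exists i, v = lift w i.
  by case: (unliftP w v) vw => [i ->|->]; [exists i | rewrite ltnn].
have jE : w = j.+1 :> nat.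
  by move: (congr1 val wE) vw => /=; rewrite /bump; case: leqP; lia.
have iE : v = i :> nat.
  by move: (congr1 val vE) vw => /=; rewrite /bump; case: leqP; lia.
have -> : unlift v w = Some j by rewrite wE liftK.
have -> : unlift w v = Some i by rewrite vE liftK.
rewrite -!fpull_comp.
have -> : face_comp (coface v) (coface j) = face_comp (coface w) (coface i).
  apply: face_map_eq => x; apply: val_inj => /=.
  have ij : (i <= j)%N by lia.
  rewrite jE iE /bump; case: (leqP j x) => jx.
    by rewrite (leq_trans ij jx) !add1n !ltnS jx (leq_trans ij (leqW jx)).
  rewrite add0n; case: (leqP i x) => ix; first by rewrite add1n ltnS leqNgt jx.
  by rewrite add0n ltnNge ltnW.
rewrite -mulNr; congr (_ * _).
by rewrite -iE jE exprS mulN1r mulNr opprK mulrC.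
Qed.

Definition fs_cochains : cochain_complex R :=
  @CochainComplex R (fun k => (L k -> R^o) : lmodType R) (fun k => @fs_diff k)
    fs_diff_diff.

End FaceSetCochains.

Definition face (m : nat) := {F : {set 'I_m} | F != set0}.

Definition face_dim m (F : face m) : nat := #|val F|.-1.

Fact face_image_subproof m l (f : face_map m l) (F : face m) :
  f @: val F != set0.
Proof. by rewrite imset_eq0 (valP F). Qed.

Definition face_image m l (f : face_map m l) (F : face m) : face l :=
  Sub (f @: val F) (face_image_subproof f F).

Section SimplexCochains.
Variable R : comPzRingType.

Definition face_sign m (F : {set 'I_m}) (v : 'I_m) : R :=
  (-1) ^+ #|[set u in F | (u < v)%N]|.

(* The coefficient of G in the boundary of F. *)
Definition incidence m (F G : face m) : R :=
  \sum_(v in val F | val F :\ v == val G) face_sign (val F) v.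

(* The differential of C^*(Delta^{m-1}; R), cochains being functions on faces,
   i.e. given by their coordinates in the dual basis 1_F. *)
Definition simplex_diff m (c : face m -> R) : face m -> R :=
  fun F => \sum_(G : face m) incidence F G * c G.

Definition ext0 m (c : face m -> R) (A : {set 'I_m}) : R :=
  oapp c 0 (insub A).

Lemma simplex_diffE m (c : face m -> R) F :
  simplex_diff c F =
  \sum_(v in val F) face_sign (val F) v * ext0 c (val F :\ v).
Proof.
rewrite /simplex_diff /incidence.
under eq_bigr do rewrite mulr_suml.
rewrite (exchange_big_dep [in val F]) /=; last by move=> ? ? _ /andP[].
apply: eq_bigr => v vF; rewrite -mulr_sumr; congr (_ * _).
rewrite /ext0; case: insubP => [G GP GE|/negPn/eqP F0] /=; last first.
  by rewrite big1 // => G /andP[_]; rewrite F0 eq_sym (negPf (valP G)).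
rewrite (big_pred1 G) // => H; rewrite vF -GE /=.
by apply/eqP/eqP => [/val_inj->|->].
Qed.

Lemma face_signN m (F : {set 'I_m}) v w : v \in F -> w \in F -> v != w ->
  face_sign F v * face_sign (F :\ v) w = - (face_sign F w * face_sign (F :\ w) v).
Proof.
suff H u t : u \in F -> t \in F -> (u < t)%N ->
    face_sign F u * face_sign (F :\ u) t =
    - (face_sign F t * face_sign (F :\ t) u).
  move=> vF wF; rewrite neq_ltn => /orP[/H->//|/H->//]; by rewrite opprK.
move=> uF tF ut; rewrite /face_sign -!exprD.
have -> : #|[set x in F | (x < t)%N]| = (#|[set x in F :\ u | (x < t)%N]|).+1.
  rewrite (cardsD1 u) inE uF ut add1n; congr _.+1; apply: eq_card => x.
  by rewrite !inE andbA.
have -> : #|[set x in F :\ t | (x < u)%N]| = #|[set x in F | (x < u)%N]|.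
  apply: eq_card => x; rewrite !inE; case: eqP => //= ->.
  by rewrite [(t < u)%N]ltnNge (ltnW ut) andbF.
by rewrite addSn exprS mulN1r opprK addnC.
Qed.

Lemma simplex_diff_diff m (c : face m -> R) F :
  simplex_diff (simplex_diff c) F = 0.
Proof.
rewrite simplex_diffE.
have E v : v \in val F -> ext0 (simplex_diff c) (val F :\ v) =
    \sum_(w in val F :\ v) face_sign (val F :\ v) w * ext0 c (val F :\ v :\ w).
  move=> vF; rewrite {1}/ext0; case: insubP => [G _ <-|/negPn/eqP->] /=.
    exact: simplex_diffE.
  by rewrite big1 // => w; rewrite inE.
pose A v w : R := if [&& v \in val F, w \in val F & v != w] then
  face_sign (val F) v * face_sign (val F :\ v) w * ext0 c (val F :\ v :\ w)
  else 0.
transitivity (\sum_(v < m) \sum_(w < m) A v w).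
  rewrite big_mkcond; apply: eq_bigr => v _; case: ifP => vF; last first.
    by rewrite big1 // => w _; rewrite /A vF.
  rewrite E // mulr_sumr big_mkcond; apply: eq_bigr => w _.
  rewrite /A vF !inE eq_sym andbC /=; case: ifP => // _; exact: mulrA.
apply: antisymmetric_sum0 => [v|v w vw]; rewrite /A ?eqxx ?andbF //.
rewrite (eq_sym w v) vw !andbT andbC.
case: ifP => [/andP[wF vF]|]; last by rewrite oppr0.
rewrite face_signN // mulNr; congr (- (_ * ext0 _ _)).
by rewrite !setDDl setUC.
Qed.

Lemma incidence_dim m (F G : face m) :
  incidence F G != 0 -> face_dim F = (face_dim G).+1.
Proof.
move=> FG; have [v /andP[vF /eqP GE]] :
    exists v, (v \in val F) && (val F :\ v == val G).
  apply/existsP; apply: contraNT FG => /existsPn nFG.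
  by apply/eqP/big1 => v /(conj (nFG v)) [/negP].
rewrite /face_dim (cardsD1 v) vF GE add1n /= prednK // card_gt0.
exact: (valP G).
Qed.

Lemma face_sign_image m l (f : face_map m l) (F : {set 'I_m}) v :
  face_sign (f @: F) (f v) = face_sign F v.
Proof.
rewrite /face_sign; congr (_ ^+ _).
have mono x y : (f x < f y)%N = (x < y)%N.
  rewrite !ltnNge; congr (~~ _); apply/idP/idP; last exact: face_fun_homo.
  case: (leqP y x) => // xy fyx.
  have fxy : (f x <= f y)%N := face_fun_homo f (ltnW xy).
  have : f x = f y by apply: val_inj; apply/eqP; rewrite eqn_leq fyx fxy.
  by move/face_fun_inj=> E; rewrite E ltnn in xy.
rewrite -(card_imset _ (@face_fun_inj _ _ f)); apply: eq_card => y.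
apply/idP/idP; last first.
  case/imsetP=> x xFv ->; move: xFv; rewrite !inE mono => /andP[xF ->].
  by rewrite imset_f.
rewrite inE => /andP[/imsetP[x xF ->]]; rewrite mono => xv.
by apply/imsetP; exists x; rewrite // inE xF.
Qed.

Lemma simplex_diff_image m l (f : face_map m l) (c : face l -> R) (F : face m) :
  simplex_diff c (face_image f F) = simplex_diff (c \o face_image f) F.
Proof.
rewrite !simplex_diffE big_imset /=; last by move=> ? ? _ _ /face_fun_inj.
apply: eq_bigr => v vF; rewrite face_sign_image; congr (_ * _).
have -> : f @: val F :\ f v = f @: (val F :\ v).
  apply/setP => y; rewrite !inE; apply/andP/imsetP => [[yv /imsetP[x xF yE]]|].
    by exists x => //; rewrite !inE xF andbT; apply: contraNneq yv => <-; apply/eqP.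
  move=> [x]; rewrite !inE => /andP[xv xF] ->; rewrite imset_f //; split=> //.
  by apply: contraNneq xv => /face_fun_inj->.
rewrite /ext0; case: insubP => [G _ GE|]; case: insubP => [H H0 HE|] //=.
- by congr c; apply: val_inj; rewrite GE /= HE.
- by move=> /negPn/eqP F0; have := valP G; rewrite GE F0 imset0 eqxx.
- by rewrite imset_eq0 H0.
Qed.

End SimplexCochains.

Section TensorCochains.
Variables (R : comPzRingType) (N : nat) (m : 'I_N -> nat).

(* A multiface F_0 x ... x F_{N-1} indexes the element
   1_{F_0} (x) ... (x) 1_{F_{N-1}} of the dual basis of the tensor product over
   R of the finite free complexes C^*(Delta^{m_i - 1}); an element of this
   tensor product is the function giving its coordinates in that basis. *)
Definition multiface := forall i : 'I_N, face (m i).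

Definition multiface_dim (F : multiface) : nat := \sum_i face_dim (F i).

Definition koszul_sign (F : multiface) (i : 'I_N) : R :=
  (-1) ^+ (\sum_(l < N | (l < i)%N) face_dim (F l)).

(* The sum over i of +- 1 (x) ... (x) d (x) ... (x) 1, in coordinates;
   see tensor_diff_pure. *)
Definition tensor_diff (w : multiface -> R) : multiface -> R :=
  fun F => \sum_(i < N) koszul_sign F i *
    simplex_diff (fun G => w (dfwith F G)) (F i).

Definition pure_tensor (c : forall i, face (m i) -> R) : multiface -> R :=
  fun F => \prod_i c i (F i).

Definition homogeneous_cochain l (p : nat) (c : face l -> R) : Prop :=
  forall F, c F != 0 -> face_dim F = p.

Lemma tensor_diff_pure (c : forall i, face (m i) -> R) (p : 'I_N -> nat) F :
    (forall i, homogeneous_cochain (p i) (c i)) ->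
  tensor_diff (pure_tensor c) F =
  \sum_(i < N) (-1) ^+ (\sum_(l < N | (l < i)%N) p l) *
    pure_tensor (dfwith c (simplex_diff (c i))) F.
Proof.
move=> cp; apply: eq_bigr => i _; rewrite /simplex_diff.
have -> : \sum_G incidence R (F i) G * pure_tensor c (dfwith F G) =
    pure_tensor (dfwith c (simplex_diff (c i))) F.
  rewrite /pure_tensor [RHS](bigD1 i) //= dfwith_in mulr_suml.
  apply: eq_bigr => G _; rewrite (bigD1 i) //= dfwith_in mulrA; congr (_ * _).
  by apply: eq_bigr => j ji; rewrite !dfwith_out // eq_sym.
have [->|nz] := eqVneq (pure_tensor (dfwith c (simplex_diff (c i))) F) 0.
  by rewrite !mulr0.
congr (_ * _); rewrite /koszul_sign; congr (_ ^+ _).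
apply: eq_bigr => l li; apply: cp; apply: contraNneq nz => c0.
rewrite /pure_tensor (bigD1 l) //= dfwith_out ?c0 ?mul0r //.
by rewrite neq_ltn li orbT.
Qed.

Lemma dfwithC (F : multiface) i j (G : face (m i)) (H : face (m j)) : i != j ->
  dfwith (dfwith F G) H = dfwith (dfwith F H) G.
Proof.
move=> ij; apply: functional_extensionality_dep => l.
have [jl|jl] := eqVneq j l.
  by subst l; rewrite dfwith_in dfwith_out // dfwith_in.
rewrite dfwith_out //; have [il|il] := eqVneq i l; first by subst l; rewrite !dfwith_in.
by rewrite !dfwith_out.
Qed.

Lemma dfwith_dfwith (F : multiface) i (G H : face (m i)) :
  dfwith (dfwith F G) H = dfwith F H.
Proof.
apply: functional_extensionality_dep => l.
have [il|il] := eqVneq i l; first by subst l; rewrite !dfwith_in.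
by rewrite !dfwith_out.
Qed.

Lemma koszul_sign_dfwith (F : multiface) i j (G : face (m i)) :
    incidence R (F i) G != 0 ->
  koszul_sign (dfwith F G) j = (-1) ^+ (i < j)%N * koszul_sign F j.
Proof.
move=> /incidence_dim FG; rewrite /koszul_sign.
have [ij|ij] := boolP (i < j)%N; last first.
  rewrite mul1r; congr (_ ^+ _); apply: eq_bigr => l lj.
  by rewrite dfwith_out //; apply: contraNneq ij => ->.
rewrite (bigD1 i) //= [in RHS](bigD1 i) //= dfwith_in FG addSn.
rewrite expr1 exprS mulrA mulN1r opprK mul1r; congr (_ ^+ (_ + _)).
by apply: eq_bigr => l /andP[_ li]; rewrite dfwith_out // eq_sym.
Qed.

Lemma tensor_diff_diff w F : tensor_diff (tensor_diff w) F = 0.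
Proof.
pose A (i j : 'I_N) : R := koszul_sign F i * \sum_G incidence R (F i) G *
  (koszul_sign (dfwith F G) j * \sum_H incidence R (dfwith F G j) H *
     w (dfwith (dfwith F G) H)).
transitivity (\sum_(i < N) \sum_(j < N) A i j).
  apply: eq_bigr => i _; rewrite -mulr_sumr; congr (_ * _).
  by rewrite exchange_big; apply: eq_bigr => G _; rewrite -mulr_sumr.
have sgn i j G : incidence R (F i) G * koszul_sign (dfwith F G) j =
    (-1) ^+ (i < j)%N * koszul_sign F j * incidence R (F i) G.
  have [->|nz] := eqVneq (incidence R (F i) G) 0; first by rewrite mul0r mulr0.
  by rewrite koszul_sign_dfwith // mulrC.
have AE i j : A i j = koszul_sign F i * koszul_sign F j * (-1) ^+ (i < j)%N *
    \sum_G \sum_H incidence R (F i) G * incidence R (dfwith F G j) H *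
      w (dfwith (dfwith F G) H).
  rewrite /A -!mulrA; congr (_ * _); rewrite !mulr_sumr; apply: eq_bigr => G _.
  rewrite mulrA sgn -!mulrA mulrCA; congr (_ * (_ * _)).
  by rewrite mulr_sumr; apply: eq_bigr => H _; rewrite mulrA.
apply: antisymmetric_sum0 => [i|i j ij]; rewrite !AE.
  rewrite [X in _ * X](_ : _ = 0) ?mulr0 //.
  rewrite -[RHS](simplex_diff_diff (fun H => w (dfwith F H)) (F i)).
  apply: eq_bigr => G _; rewrite [RHS]mulr_sumr; apply: eq_bigr => H _.
  by rewrite dfwith_in dfwith_dfwith mulrA.
have -> : (-1) ^+ (i < j)%N = - (-1) ^+ (j < i)%N :> R.
  by case: ltngtP ij => [|| /val_inj ->]; rewrite ?eqxx // ?opprK.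
rewrite mulrN mulNr [koszul_sign F i * _]mulrC; congr (- (_ * _)).
rewrite exchange_big; apply: eq_bigr => H _; apply: eq_bigr => G _.
rewrite [in RHS]dfwith_out 1?eq_sym // dfwith_out // dfwithC //.
by rewrite [X in X * _]mulrC.
Qed.

Lemma tensor_diff_homogeneous w p :
    (forall F, w F != 0 -> multiface_dim F = p) ->
  forall F, tensor_diff w F != 0 -> multiface_dim F = p.+1.
Proof.
move=> wp F; have [//|Fp] := eqVneq (multiface_dim F) p.+1.
rewrite /tensor_diff big1 ?eqxx // => i _; rewrite [X in _ * X]big1 ?mulr0 //.
move=> G _; have [->|FG] := eqVneq (incidence R (F i) G) 0; first exact: mul0r.
have [->|/wp wG] := eqVneq (w (dfwith F G)) 0; first exact: mulr0.
case/eqP: Fp; rewrite -wG /multiface_dim (bigD1 i) //= [in RHS](bigD1 i) //=.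
rewrite dfwith_in (incidence_dim FG) addSn; congr (_ + _).+1.
by apply: eq_bigr => l li; rewrite dfwith_out // eq_sym.
Qed.

End TensorCochains.

(* The object Delta^{j_0} * ... * Delta^{j_n}, with verts i = j_i + 1. *)
Record filtered_simplex (n : nat) := FilteredSimplex {
  verts :> 'I_n.+1 -> nat;
  verts_neq0 : [exists i, verts i != 0] }.

Definition filtered_map n (a b : filtered_simplex n) : Type :=
  forall i, face_map (a i) (b i).

Definition filtered_id n (a : filtered_simplex n) : filtered_map a a :=
  fun i => face_id (a i).

Definition filtered_comp n (a b c : filtered_simplex n)
    (g : filtered_map b c) (f : filtered_map a b) : filtered_map a c :=
  fun i => face_comp (g i) (f i).

Record filtered_face_set (n : nat) := FilteredFaceSet {
  simplices :> filtered_simplex n -> Type;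
  pull : forall a b, filtered_map a b -> simplices b -> simplices a;
  pull_id : forall a (s : simplices a), pull (filtered_id a) s = s;
  pull_comp : forall a b c (f : filtered_map a b) (g : filtered_map b c)
    (s : simplices c), pull (filtered_comp g f) s = pull f (pull g s) }.

Section RegularPart.
Variable n : nat.

(* The object with j_i = -1 for i < n and j_n = k. *)
Definition regular_verts (k : nat) (i : 'I_n.+1) : nat :=
  if i == ord_max then k.+1 else 0%N.

Fact regular_verts_neq0 k : [exists i, regular_verts k i != 0%N].
Proof. by apply/existsP; exists ord_max; rewrite /regular_verts eqxx. Qed.

Definition regular_simplex (k : nat) : filtered_simplex n :=
  FilteredSimplex (regular_verts_neq0 k).

Definition regular_map k l (f : face_map k.+1 l.+1) :
    filtered_map (regular_simplex k) (regular_simplex l) :=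
  fun i =>
    match i == ord_max as b
    return face_map (if b then k.+1 else 0) (if b then l.+1 else 0) with
    | true => f
    | false => face_id 0
    end.

Lemma regular_map_id k : regular_map (face_id k.+1) = filtered_id _.
Proof.
apply: functional_extensionality_dep => i.
rewrite /regular_map /filtered_id /regular_simplex /= /regular_verts.
by case: (i == ord_max).
Qed.

Lemma regular_map_comp k l p (f : face_map k.+1 l.+1)
    (g : face_map l.+1 p.+1) :
  regular_map (face_comp g f) = filtered_comp (regular_map g) (regular_map f).
Proof.
apply: functional_extensionality_dep => i.
rewrite /regular_map /filtered_comp /regular_simplex /= /regular_verts.
by case: (i == ord_max) => //; apply: face_map_eq => -[].
Qed.

Variable K : filtered_face_set n.

Fact regular_pull_id k (s : K (regular_simplex k)) :
  pull (regular_map (face_id k.+1)) s = s.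
Proof. by rewrite regular_map_id pull_id. Qed.

Fact regular_pull_comp k l p (f : face_map k.+1 l.+1) (g : face_map l.+1 p.+1)
    (s : K (regular_simplex p)) :
  pull (regular_map (face_comp g f)) s =
  pull (regular_map f) (pull (regular_map g) s).
Proof. by rewrite regular_map_comp pull_comp. Qed.

(* K^[0] *)
Definition regular_part : face_set :=
  @FaceSet (fun k => K (regular_simplex k)) (fun k l f => pull (regular_map f))
    regular_pull_id regular_pull_comp.

(* K_+ *)
Record plus_simplex := PlusSimplex {
  plus_shape : filtered_simplex n;
  plus_shape_gt0 : (0 < plus_shape ord_max)%N;
  plus_val :> K plus_shape }.

Definition plus_pull (s : plus_simplex) (a : filtered_simplex n)
    (a_gt0 : (0 < a ord_max)%N) (f : filtered_map a (plus_shape s)) :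
    plus_simplex :=
  PlusSimplex a_gt0 (pull f (plus_val s)).

End RegularPart.

Arguments plus_shape {n K}.

Section BlowUp.
Variable n : nat.
Implicit Types a b : filtered_simplex n.

(* Numbers of vertices of the factors of
   c Delta^{j_0} x ... x c Delta^{j_(n-1)} x Delta^{j_n}. *)
Definition blowup_verts a (i : 'I_n.+1) : nat :=
  if i == ord_max then a i else (a i).+1.

Definition blowup_map a b (f : filtered_map a b) (i : 'I_n.+1) :
    face_map (blowup_verts a i) (blowup_verts b i) :=
  match i == ord_max as c
  return face_map (if c then a i else (a i).+1) (if c then b i else (b i).+1)
  with
  | true => f i
  | false => cone_map (f i)
  end.

Definition blowup_image a b (f : filtered_map a b)
    (F : multiface (blowup_verts a)) : multiface (blowup_verts b) :=
  fun i => face_image (blowup_map f i) (F i).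

Lemma blowup_image_dfwith a b (f : filtered_map a b) F i G :
  blowup_image f (dfwith F G) =
  dfwith (blowup_image f F) (face_image (blowup_map f i) G).
Proof.
apply: functional_extensionality_dep => j; rewrite /blowup_image.
have [ij|ij] := eqVneq i j; first by subst j; rewrite !dfwith_in.
by rewrite !dfwith_out.
Qed.

Lemma face_image_dim m l (f : face_map m l) F :
  face_dim (face_image f F) = face_dim F.
Proof. by rewrite /face_dim /= (card_imset _ (@face_fun_inj _ _ f)). Qed.

Lemma pure_tensor_blowup (R : comPzRingType) a b (f : filtered_map a b)
    (c : forall i, face (blowup_verts b i) -> R) F :
  pure_tensor c (blowup_image f F) =
  pure_tensor (fun i => c i \o face_image (blowup_map f i)) F.
Proof. by []. Qed.

Lemma tensor_diff_blowup (R : comPzRingType) a b (f : filtered_map a b)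
    (w : multiface (blowup_verts b) -> R) F :
  tensor_diff w (blowup_image f F) = tensor_diff (w \o blowup_image f) F.
Proof.
apply: eq_bigr => i _; congr (_ * _).
  by congr (_ ^+ _); apply: eq_bigr => l _; rewrite face_image_dim.
rewrite simplex_diff_image; apply: eq_bigr => G _ /=.
by rewrite blowup_image_dfwith.
Qed.

End BlowUp.

Section ThomWhitney.
Variables (R : comPzRingType) (n : nat) (K : filtered_face_set n).

(* A family (w_s) indexed by K_+, with w_s in the tensor product attached to
   the shape of s, is given by all the coordinates of all the w_s. *)
Definition tw_index : Type :=
  {s : plus_simplex K & multiface (blowup_verts (plus_shape s))}.

Definition tw_component (w : tw_index -> R^o) (s : plus_simplex K) :
    multiface (blowup_verts (plus_shape s)) -> R :=
  fun F => w (existT _ s F).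

Arguments tw_component w s F : clear implicits.

(* w_(s o f) = f^* w_s *)
Definition tw_natural (w : tw_index -> R^o) : Prop :=
  forall (s : plus_simplex K) (a : filtered_simplex n)
    (a_gt0 : (0 < a ord_max)%N) (f : filtered_map a (plus_shape s)) F,
  tw_component w (plus_pull a_gt0 f) F = tw_component w s (blowup_image f F).

Definition tw_homogeneous (k : nat) (w : tw_index -> R^o) : Prop :=
  forall (s : plus_simplex K) F, tw_component w s F != 0 -> multiface_dim F = k.

Definition tw_mem (k : nat) : pred (tw_index -> R^o) :=
  fun w => `[< tw_homogeneous k w /\ tw_natural w >].

Fact tw_mem_closed k : submod_closed (tw_mem k).
Proof.
split=> [|a w w' /asboolP[wk wn] /asboolP[wk' wn']]; apply/asboolP.
  by split=> // s F /eqP[].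
split=> [s F|s b b_gt0 f F]; rewrite /tw_component !fctE; last first.
  by have := wn s b b_gt0 f F; have := wn' s b b_gt0 f F;
     rewrite /tw_component => -> ->.
have [w0|/wk//] := eqVneq (tw_component w s F) 0.
have [w0'|/wk'//] := eqVneq (tw_component w' s F) 0.
by rewrite /tw_component in w0 w0'; rewrite w0 w0' scaler0 addr0 eqxx.
Qed.

HB.instance Definition _ k :=
  GRing.isSubmodClosed.Build R (tw_index -> R^o) (tw_mem k) (tw_mem_closed k).

Record tw_cochain (k : nat) := TWCochain {
  tw_family :> tw_index -> R^o; tw_familyP : tw_family \in tw_mem k }.

HB.instance Definition _ k := [isSub for @tw_family k].
HB.instance Definition _ k := [Choice of tw_cochain k by <:].
HB.instance Definition _ k := [SubChoice_isSubLmodule of tw_cochain k by <:].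

Definition tw_diff_family (w : tw_index -> R^o) : tw_index -> R^o :=
  fun x => tensor_diff (tw_component w (projT1 x)) (projT2 x).

Fact tw_diff_subproof k (w : tw_cochain k) : tw_diff_family w \in tw_mem k.+1.
Proof.
have /asboolP[wk wn] := tw_familyP w; apply/asboolP; split=> [s F|].
  by apply: tensor_diff_homogeneous; exact: wk.
move=> s a a_gt0 f F; rewrite /tw_component /tw_diff_family /=.
rewrite tensor_diff_blowup; congr (tensor_diff _ F).
apply/funext => G; exact: wn.
Qed.

Definition tw_diff k (w : tw_cochain k) : tw_cochain k.+1 :=
  TWCochain (tw_diff_subproof w).

Fact tw_diff_linear k : linear (@tw_diff k).
Proof.
move=> a w w'; apply: val_inj; apply/funext => -[s F] /=.
rewrite /tw_diff_family !fctE /tensor_diff /= [a *: _]mulr_sumr -big_split /=.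
apply: eq_bigr => i _; rewrite mulrCA -mulrDr; congr (_ * _).
rewrite /simplex_diff mulr_sumr -big_split; apply: eq_bigr => G _ /=.
rewrite mulrCA -mulrDr; congr (_ * _).
Qed.

HB.instance Definition _ k :=
  GRing.isLinear.Build R (tw_cochain k) (tw_cochain k.+1) _ (@tw_diff k)
    (@tw_diff_linear k).

Fact tw_diff_diff k (w : tw_cochain k) : tw_diff (tw_diff w) = 0.
Proof.
apply: val_inj; apply/funext => -[s F].
exact: (tensor_diff_diff (tw_component w s) F).
Qed.

(* For the infinite perversity no admissibility condition is imposed. *)
Definition tw_complex : cochain_complex R :=
  @CochainComplex R (fun k => tw_cochain k : lmodType R) (fun k => @tw_diff k)
    tw_diff_diff.

Fact regular_shape_gt0 k : (0 < regular_simplex n k ord_max)%N.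
Proof. by rewrite /= /regular_verts eqxx. Qed.

Definition regular_plus k (s : regular_part K k) : plus_simplex K :=
  PlusSimplex (regular_shape_gt0 k) s.

Fact top_multiface_subproof k i :
  [set: 'I_(blowup_verts (regular_simplex n k) i)] != set0.
Proof.
rewrite -card_gt0 cardsT card_ord /blowup_verts /= /regular_verts.
by case: (i == ord_max).
Qed.

(* The multiface {pt} x ... x {pt} x Delta^k. *)
Definition top_multiface k : multiface (blowup_verts (regular_simplex n k)) :=
  fun i => Sub [set: _] (top_multiface_subproof k i).

(* As C^*(c emptyset; R) = R, w_s is an element of C^k(Delta^k; R) for s in
   K^[0]_k, given by its value on Delta^k. *)
Definition restriction_fun k (w : tw_cochain k) : regular_part K k -> R^o :=
  fun s => tw_component w (regular_plus s) (top_multiface k).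

Fact restriction_linear k : linear (@restriction_fun k).
Proof. by []. Qed.

HB.instance Definition _ k :=
  GRing.isLinear.Build R (tw_cochain k) (regular_part K k -> R^o) _
    (@restriction_fun k) (@restriction_linear k).

Lemma top_multiface_dim k i : i != ord_max -> face_dim (top_multiface k i) = 0%N.
Proof.
move=> /negPf im; rewrite /face_dim /= cardsT card_ord.
by rewrite /blowup_verts /= /regular_verts im.
Qed.

Lemma blowup_image_coface k (i : 'I_k.+2) j :
  val (blowup_image (regular_map (coface i)) (top_multiface k) j) =
  [set x : 'I_(blowup_verts (regular_simplex n k.+1) j) |
    (j == ord_max) ==> (val x != i :> nat)].
Proof.
rewrite /blowup_image /blowup_map /top_multiface /regular_map /=.
rewrite /blowup_verts /= /regular_verts.
case: (j == ord_max) => /=; apply/setP => x; rewrite !inE.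
  apply/imsetP/idP => [[y _ ->]|xi].
    by apply/eqP => /val_inj/eqP; rewrite eq_sym (negPf (neq_lift i y)).
  case: (unliftP i x) xi => [y ->|->]; last by rewrite eqxx.
  by move=> _; exists y; rewrite ?inE.
by apply/imsetP; exists ord0; rewrite ?inE ?(ord1 x) ?(ord1 (cone_fun _ _)).
Qed.

Fact restriction_diff k (w : tw_cochain k) :
  restriction_fun (tw_diff w) = fs_diff (restriction_fun w).
Proof.
have /asboolP[_ wn] := tw_familyP w.
apply/funext => s; rewrite /restriction_fun /tw_component /= /tw_diff_family /=.
rewrite /tensor_diff (bigD1 ord_max) //= [X in _ + X]big1 ?addr0; last first.
  move=> i im; rewrite [X in _ * X]big1 ?mulr0 // => G _.
  have [->|/incidence_dim] := eqVneq (incidence R (top_multiface k.+1 i) G) 0.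
    exact: mul0r.
  by rewrite top_multiface_dim.
rewrite [koszul_sign _ _ _](_ : _ = 1) ?mul1r; last first.
  rewrite /koszul_sign big1 ?expr0 // => l lm.
  by rewrite top_multiface_dim // neq_ltn lm.
have e : k.+2 = blowup_verts (regular_simplex n k.+1) ord_max.
  by rewrite /blowup_verts /= /regular_verts eqxx.
rewrite simplex_diffE (reindex (cast_ord e)) /=; last first.
  by exists (cast_ord (esym e)) => x _; rewrite ?cast_ordK ?cast_ordKV.
apply: eq_big => [i|i _]; first by rewrite inE.
congr (_ * _).
  congr (_ ^+ _); rewrite -[RHS](card_ord i).
  have ik' : (i <= blowup_verts (regular_simplex n k.+1) ord_max)%N.
    by rewrite -e ltnW.
  have wi : injective (widen_ord ik') by move=> x y /(congr1 val) /= xy; exact: val_inj.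
  rewrite -cardsT -(card_imset _ wi); apply: eq_card => u.
  apply/idP/imsetP => [|[v _ ->]]; last by rewrite !inE /=.
  rewrite !inE /= => ui; exists (Ordinal ui) => //; exact: val_inj.
set top := top_multiface k.
have := wn (regular_plus s) _ (regular_shape_gt0 k) (regular_map (coface i)) top.
rewrite /tw_component /= => ->.
rewrite /ext0; case: insubP => [G _ GE|/negP[]] /=; last first.
  rewrite (_ : _ :\ _ =
    val (blowup_image (regular_map (coface i)) top ord_max)).
    exact: (valP (blowup_image (regular_map (coface i)) top ord_max)).
  by rewrite blowup_image_coface eqxx; apply/setP => x; rewrite !inE andbT.
congr (tw_family w (existT _ _ _)).
apply: functional_extensionality_dep => j; apply: val_inj.
rewrite blowup_image_coface; have [jm|jm] := eqVneq ord_max j.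
  subst j; rewrite dfwith_in GE.
  by apply/setP => x; rewrite !inE andbT.
by rewrite dfwith_out //; apply/setP => x; rewrite !inE.
Qed.

Definition restriction : chain_map tw_complex (fs_cochains R (regular_part K)) :=
  @ChainMap R tw_complex (fs_cochains R (regular_part K))
    (fun k => @restriction_fun k) restriction_diff.

End ThomWhitney.

Arguments tw_component {R n K} w s F.

(* Main.v *)
(* Inserting the cone point of c Delta^{j_i} into the i-th factor is a
   contracting homotopy of the augmented complex of that factor, and it is
   natural because the cones of face maps preserve cone points.  Hence the
   operator pi_i, which kills a multiface whose i-th factor has positive
   dimension and otherwise replaces this factor by the cone point, is homotopic
   to the identity of the Thom-Whitney complex.  By naturality a family fixed by
   all pi_i, i < n, depends only on its restriction to K^[0]: the product of the
   pi_i is the restriction followed by a section of it, so that this section is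
   a chain map and a homotopy inverse of the restriction. *)
Require Import Defs.
From HB Require Import structures.
From mathcomp Require Import all_boot all_algebra.
From mathcomp Require Import boolp functions.
From mathcomp Require Import ring.
Import GRing.Theory.

Set Implicit Arguments.
Unset Strict Implicit.
Unset Printing Implicit Defensive.

Local Open Scope ring_scope.

(** * The contracting homotopy of a simplex *)

Section FaceHomotopy.
Variables (R : comPzRingType) (m : nat) (c : 'I_m).

Fact add_vertex_subproof (F : face m) : c |: val F != set0.
Proof. by apply/set0Pn; exists c; rewrite setU11. Qed.

Definition add_vertex (F : face m) : face m :=
  exist _ (c |: val F) (add_vertex_subproof F).

Fact vertex_face_subproof : [set c] != set0.
Proof. by apply/set0Pn; exists c; rewrite set11. Qed.

Definition vertex_face : face m :=
  exist _ [set c] vertex_face_subproof.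

Lemma face_dim_eq0 (F : face m) v : v \in val F ->
  (face_dim F == 0%N) = (val F :\ v == set0).
Proof. by move=> vF; rewrite /face_dim (cardsD1 v) vF add1n cards_eq0. Qed.

Lemma add_vertex_dim (F : face m) : c \notin val F ->
  face_dim (add_vertex F) = (face_dim F).+1.
Proof.
by move=> cF; rewrite /face_dim cardsU1 cF prednK // card_gt0 (valP F).
Qed.

(** The dual of the chain operator joining [c] to a face. The sign is the incidence of [c |: F] with
    [F], so [c] may stand anywhere in the vertex order. *)
Definition face_htpy (g : face m -> R) (F : face m) : R :=
  if c \in val F then 0 else face_sign R (val F) c * g (add_vertex F).

Lemma ext0E (g : face m -> R) (F : face m) : ext0 g (val F) = g F.
Proof. by rewrite /ext0 valK. Qed.

Lemma face_signK (A : {set 'I_m}) v : face_sign R A v * face_sign R A v = 1.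
Proof. by rewrite /face_sign -expr2 sqrr_sign. Qed.

Lemma face_signU1 (A : {set 'I_m}) v :
  face_sign R (v |: A) v = face_sign R A v.
Proof.
congr (_ ^+ _); apply: eq_card => u; rewrite !inE.
by have [->|] := eqVneq u v; rewrite ?ltnn ?andbF.
Qed.

Lemma face_signD1 (A : {set 'I_m}) v :
  face_sign R (A :\ v) v = face_sign R A v.
Proof.
congr (_ ^+ _); apply: eq_card => u; rewrite !inE.
by have [->|] := eqVneq u v; rewrite ?ltnn ?andbF.
Qed.

Lemma face_sign0 v : face_sign R (set0 : {set 'I_m}) v = 1.
Proof. by rewrite /face_sign eq_card0 // => u; rewrite !inE. Qed.

Lemma ext0_face_htpy (g : face m -> R) (A : {set 'I_m}) :
  ext0 (face_htpy g) A = if (A == set0) || (c \in A) then 0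
                         else face_sign R A c * ext0 g (c |: A).
Proof.
have [->|A0] /= := eqVneq A set0; first by rewrite /ext0 insubF ?eqxx.
pose F : face m := Sub A A0.
by rewrite -[A]/(val F) ext0E /face_htpy -(ext0E g (add_vertex F)).
Qed.

(** If [c] lies in [F], only the deletion of [c] contributes. Otherwise deleting [c] from [c |: F]
    gives [g F], and the other deletions cancel in pairs by [face_signN]. The correction term
    appears when a deletion leaves the empty set, where [ext0] is 0. *)
Lemma face_htpyP (g : face m -> R) (F : face m) :
  simplex_diff (face_htpy g) F + face_htpy (simplex_diff g) F =
  g F - (if face_dim F == 0%N then g vertex_face else 0).
Proof.
rewrite simplex_diffE.
under eq_bigr do rewrite ext0_face_htpy.
have [cF|cF] := boolP (c \in val F).
  rewrite /face_htpy cF addr0 (bigD1 c) //= big1 ?addr0; last first.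
    move=> v /andP[_ vc].
    by rewrite [_ || _](_ : _ = true) ?mulr0 // !inE (eq_sym c) vc cF orbT.
  rewrite (face_dim_eq0 cF) setD11 orbF setD1K // face_signD1.
  have [F0|_] := eqVneq; last by rewrite mulrA face_signK mul1r ext0E subr0.
  rewrite mulr0 (_ : vertex_face = F) ?subrr //; apply: val_inj => /=.
  by rewrite -(setD1K cF) F0 setU0.
rewrite /face_htpy (negPf cF) simplex_diffE /= (big_setU1 _ cF) /=.
rewrite setU1K // face_signU1 mulrDr mulrA face_signK mul1r ext0E.
rewrite addrCA; congr (_ + _); rewrite mulr_sumr -big_split /=.
have vD v : v \in val F -> (c |: val F) :\ v = c |: (val F :\ v).
  move=> vF; apply/setP => u; rewrite !inE; have [->|//] := eqVneq u c.
  by rewrite andbT; apply: contraNneq cF => ->.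
(* This is [face_signN] for [c |: val F], with two signs moved across the equation because signs
   square to 1. *)
have sgn v : v \in val F ->
    face_sign R (val F) c * face_sign R (c |: val F) v =
    - (face_sign R (val F) v * face_sign R (val F :\ v) c).
  move=> vF; have cv : c != v by apply: contraNneq cF => ->.
  have := @face_signN R _ (c |: val F) c v (setU11 _ _) (setU1r _ vF) cv.
  rewrite setU1K // face_signU1.
  rewrite vD // face_signU1 => e.
  transitivity (face_sign R (val F) c * face_sign R (val F) v *
      (face_sign R (c |: val F) v * face_sign R (val F) v)).
    by rewrite mulrACA face_signK mulr1.
  rewrite e -[in RHS](mul1r (_ * _)) -(face_signK (c |: val F) v); ring.
(* A pair fails to cancel only if [F] is the single vertex [v]; then the homotopy term vanishes and
   [- g vertex_face] is left. *)
transitivity (\sum_(v in val F)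
    (if val F :\ v == set0 then - g vertex_face else 0)).
  apply: eq_bigr => v vF.
  rewrite mulrA sgn // vD // !inE (negPf cF) andbF orbF mulNr.
  have [F0|F0] := eqVneq; last by rewrite mulrA subrr.
  rewrite -(face_signD1 (val F) v) F0 !face_sign0 mulr0 add0r !mul1r setU0.
  by rewrite -(ext0E g vertex_face).
rewrite -big_mkcondr /=; have [F0|F0] := eqVneq (face_dim F) 0%N.
  have /cards1P[v Fv] : #|val F| == 1%N.
    by rewrite -[1%N]/(0.+1) -F0 prednK // card_gt0 (valP F).
  rewrite (big_pred1 v) // => u; rewrite Fv !inE /=.
  by have [->|//] := eqVneq u v; rewrite setDv eqxx.
rewrite big_pred0 ?oppr0 // => v; apply: contraNF F0 => /andP[vF Fv].
by rewrite (face_dim_eq0 vF).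
Qed.

(** Isolates the factor independent of the cochain, which makes the linearity of [face_htpy] usable
    by rewriting. *)
Definition htpy_coef (F : face m) : R :=
  if c \in val F then 0 else face_sign R (val F) c.

Lemma face_htpyE g F : face_htpy g F = htpy_coef F * g (add_vertex F).
Proof. by rewrite /face_htpy /htpy_coef; case: ifP; rewrite ?mul0r. Qed.

End FaceHomotopy.

(** * The homotopy on one factor of a tensor product *)

Section TensorHomotopy.
Variables (R : comPzRingType) (N : nat) (m : 'I_N -> nat).
Implicit Types (w : multiface m -> R) (F : multiface m).

Lemma dfwith_id F i : dfwith F (F i) = F.
Proof.
apply: functional_extensionality_dep => j.
have [ij|ij] := eqVneq i j; last by rewrite dfwith_out.
by subst j; rewrite dfwith_in.
Qed.

Lemma koszul_sign_dfwith_ge F (i j : 'I_N) (G : face (m i)) : (j <= i)%N ->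
  koszul_sign R (dfwith F G) j = koszul_sign R F j.
Proof.
move=> ji; congr (_ ^+ _); apply: eq_bigr => l lj; rewrite dfwith_out //.
by rewrite neq_ltn (leq_trans lj ji) orbT.
Qed.

(** Serves for the passage from a face to its join with [c], where the dimensions are known but no
    nonzero incidence is at hand. *)
Lemma koszul_sign_dim F (i j : 'I_N) (G : face (m i)) :
    face_dim (F i) = (face_dim G).+1 ->
  koszul_sign R (dfwith F G) j = (-1) ^+ (i < j)%N * koszul_sign R F j.
Proof.
move=> FG; have [ij|ij] := ltnP i j; last first.
  by rewrite mul1r koszul_sign_dfwith_ge.
rewrite /koszul_sign (bigD1 i) //= [in RHS](bigD1 i) //= dfwith_in FG addSn.
rewrite expr1 exprS mulrA mulN1r opprK mul1r; congr (_ ^+ (_ + _)).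
by apply: eq_bigr => l /andP[_ li]; rewrite dfwith_out // eq_sym.
Qed.

Variables (i : 'I_N) (c : 'I_(m i)).

Definition tensor_htpy w F : R :=
  koszul_sign R F i * face_htpy c (fun G => w (dfwith F G)) (F i).

(** On the [i]-th factor this is evaluation at [c] followed by the inclusion of constant 0-cochains;
    it is the identity on the other factors. *)
Definition tensor_proj w F : R :=
  if face_dim (F i) == 0%N then w (dfwith F (vertex_face c)) else 0.

Lemma koszul_signK F j : koszul_sign R F j * koszul_sign R F j = 1.
Proof. by rewrite /koszul_sign -expr2 sqrr_sign. Qed.

Lemma simplex_diff_scale l a (g h : face l -> R) :
    (forall G, h G = a * g G) ->
  forall G, simplex_diff h G = a * simplex_diff g G.
Proof.
move=> hg G; rewrite /simplex_diff mulr_sumr; apply: eq_bigr => H _.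
by rewrite hg mulrCA.
Qed.

(** In factor [i] the Koszul signs square to 1 and [face_htpyP] applies. For [j != i] the summands
    of the two composites are opposite: if [i < j], joining [c] flips the sign at [j]; if [j < i],
    the differential in factor [j] flips the sign at [i]. *)
Lemma tensor_htpyP w F :
  tensor_diff (tensor_htpy w) F + tensor_htpy (tensor_diff w) F =
  w F - tensor_proj w F.
Proof.
pose g (G : face (m i)) := w (dfwith F G).
pose F' := dfwith F (add_vertex c (F i)).
rewrite {1}/tensor_diff (bigD1 i) //=.
rewrite (@simplex_diff_scale _ (koszul_sign R F i) (face_htpy c g)); last first.
  move=> G; rewrite /tensor_htpy koszul_sign_dfwith_ge // dfwith_in.
  by rewrite !face_htpyE /g dfwith_dfwith.
rewrite mulrA koszul_signK mul1r.
rewrite /(tensor_htpy (tensor_diff _)) face_htpyE -/F' /tensor_diff.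
rewrite [X in _ * (_ * X)](bigD1 i) //=.
have -> : simplex_diff (fun G => w (dfwith F' G)) (F' i) =
    simplex_diff g (add_vertex c (F i)).
  rewrite {2}/F' dfwith_in; congr (simplex_diff _ _); apply/funext => G.
  by rewrite /F' dfwith_dfwith.
have ksK (k h x y : R) : k * k = 1 ->
    k * (h * (k * x + y)) = h * x + k * (h * y).
  by move=> kk; rewrite mulrDr mulrDr mulrCA (mulrA k k) kk mul1r.
rewrite koszul_sign_dfwith_ge // ksK ?koszul_signK // -(face_htpyE c).
rewrite addrACA face_htpyP /g dfwith_id -[in RHS](addr0 (w F - _)).
congr (_ + _); rewrite 2!mulr_sumr -big_split big1 //= => j ji.
rewrite {1}/simplex_diff /simplex_diff !mulr_sumr -big_split big1 //= => G _.
have ij : i != j by rewrite eq_sym.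
rewrite /tensor_htpy {2}/F' !dfwith_out // face_htpyE dfwithC // -/F'.
rewrite /htpy_coef; case: ifPn => cF; first by rewrite !(mul0r, mulr0) addr0.
have [->|FG] := eqVneq (incidence R (F j) G) 0.
  by rewrite !(mul0r, mulr0) addr0.
rewrite koszul_sign_dfwith //.
have -> : koszul_sign R F j = (-1) ^+ (i < j)%N * koszul_sign R F' j.
  have F'i : face_dim (F' i) = (face_dim (F i)).+1.
    by rewrite /F' dfwith_in add_vertex_dim.
  by rewrite -(koszul_sign_dim j F'i) /F' dfwith_dfwith dfwith_id.
(* Exactly one of [i < j] and [j < i] holds, hence exactly one sign changes. *)
by move: ij; rewrite neq_ltn; case: ltngtP => //= _ _; ring.
Qed.

End TensorHomotopy.

(** * Face maps and their images *)

Section FaceMaps.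

Lemma face_map_ltn m l (f : face_map m l) x y : (f x < f y)%N = (x < y)%N.
Proof.
have lt_mono (u v : 'I_m) : (u < v)%N -> (f u < f v)%N.
  move=> uv; rewrite ltn_neqAle (face_fun_homo f (ltnW uv)) andbT.
  by apply: contraTneq uv => /val_inj/face_fun_inj->; rewrite ltnn.
apply/idP/idP => [fxy|]; last exact: lt_mono.
have [//|/lt_mono/ltnW|/val_inj xy] := ltngtP x y; first by rewrite leqNgt fxy.
by rewrite xy ltnn in fxy.
Qed.

(** The map is recovered from its image: exactly [x] elements of the image lie below [h x]. *)
Lemma face_map_image_inj m l (f g : face_map m l) :
  f @: setT = g @: setT -> f = g.
Proof.
have rank (h : face_map m l) x :
    #|[set y in h @: setT | (y < h x)%N]| = x.
  have -> : [set y in h @: setT | (y < h x)%N] =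
      h @: [set z : 'I_m | (z < x)%N].
    apply/setP => y; rewrite !inE; apply/andP/imsetP.
      by move=> [/imsetP[z _ ->]]; rewrite face_map_ltn; exists z; rewrite ?inE.
    by move=> [z]; rewrite inE => zx ->; rewrite imset_f // face_map_ltn.
  rewrite (card_imset _ (@face_fun_inj _ _ h)).
  have wi : injective (widen_ord (ltnW (ltn_ord x))).
    by move=> u v /(congr1 val) /= /val_inj.
  rewrite -[RHS]card_ord -cardsT -(card_imset _ wi); apply: eq_card => z.
  rewrite inE; apply/idP/imsetP => [zx|[u _ ->] //=].
  by exists (Ordinal zx) => //; apply: val_inj.
suff H (h h' : face_map m l) x : h @: setT = h' @: setT -> (h x <= h' x)%N.
  move=> fg; apply: face_map_eq => x; apply: val_inj.
  by apply/eqP; rewrite eqn_leq !H.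
move=> hh'; rewrite leqNgt; apply/negP => h'hx.
(* The element [h' x] itself makes the inclusion strict, although both sets have [x] elements. *)
have : [set y in h' @: setT | (y < h' x)%N] \proper
    [set y in h @: setT | (y < h x)%N].
  apply/properP; split.
    apply/subsetP => y; rewrite !inE hh' => /andP[-> yh'].
    exact: ltn_trans yh' h'hx.
  by exists (h' x); rewrite !inE ?ltnn ?andbF // hh' imset_f.
by move/proper_card; rewrite !rank ltnn.
Qed.

Variables (m p : nat) (A : {set 'I_m}) (Ap : #|A| = p).

(** The cardinality is a separate [p], so that the source can be a factor of [regular_simplex]
    without a cast in its type. *)
Definition face_incl_fun (x : 'I_p) : 'I_m := enum_val (cast_ord (esym Ap) x).

Fact face_incl_inj : injective face_incl_fun.
Proof. by move=> x y /enum_val_inj/cast_ord_inj. Qed.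

Fact face_incl_homo : {homo face_incl_fun : x y / (x <= y)%N}.
Proof.
move=> x y xy; have x0 : 'I_m := face_incl_fun x.
rewrite /face_incl_fun !(enum_val_nth x0) /=.
have srt : sorted (fun u v : 'I_m => (u <= v)%N) (enum A).
  (* A sublist of the increasing list of all vertices is increasing. *)
  have -> : enum A = filter (mem A) (enum 'I_m) by rewrite enumT.
  apply: sorted_filter; first by move=> ? ? ?; exact: leq_trans.
  by rewrite -(sorted_map (e' := leq) (f := val)) val_enum_ord iota_sorted.
apply: (sorted_leq_nth _ _ x0 srt) => //; rewrite ?inE -?cardE ?Ap //.
by move=> ? ? ?; exact: leq_trans.
Qed.

Definition face_incl : face_map p m := FaceMap face_incl_inj face_incl_homo.

Lemma face_incl_image : face_incl @: setT = A.
Proof.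
apply/eqP; rewrite eqEcard (card_imset _ face_incl_inj) cardsT card_ord Ap.
rewrite leqnn andbT; apply/subsetP => y /imsetP[x _ ->]; exact: enum_valP.
Qed.

End FaceMaps.

(** * Cone points and traces on the last factor *)

Section ConeVertices.
Variable n : nat.
Implicit Types a b : filtered_simplex n.

Fact cone_vertex_subproof a (i : 'I_n) :
  (a (lift ord_max i) < blowup_verts a (lift ord_max i))%N.
Proof. by rewrite /blowup_verts eq_sym (negPf (neq_lift _ _)). Qed.

Definition cone_vertex a (i : 'I_n) : 'I_(blowup_verts a (lift ord_max i)) :=
  Ordinal (cone_vertex_subproof a i).

Lemma blowup_map_cone a b (f : filtered_map a b) i :
  blowup_map f (lift ord_max i) (cone_vertex a i) = cone_vertex b i.
Proof.
apply: val_inj => /=; set j := lift _ _.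
have : j != ord_max by rewrite eq_sym neq_lift.
(* Only the number of the cone point is kept: its type depends on the test [j == ord_max], which can
   be destructed once the vertex is generalised. *)
have : val (cone_vertex a i) = a j by [].
move: (cone_vertex a i); rewrite -/j /blowup_map /blowup_verts.
case: (j == ord_max) => //= x xa _; rewrite /cone_fun.
case: (unliftP ord_max x) => [y xy|//].
by have := ltn_ord y; rewrite -[X in (X < _)%N]lift_max -xy xa ltnn.
Qed.

(* For j = ord_max the two vertex sets agree, but only up to a conversion
   blocked by the test j == ord_max; for j != ord_max the trace is empty. *)
Definition regular_trace a j (A : {set 'I_(blowup_verts a j)}) :
    {set 'I_(a j)} :=
  [set x | (j == ord_max) && [exists y in A, val y == val x]].

Lemma regular_trace_image a b (f : filtered_map a b) j
    (A : {set 'I_(blowup_verts a j)}) :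
  regular_trace (blowup_map f j @: A) = f j @: regular_trace A.
Proof.
move: A; rewrite /regular_trace /blowup_map /blowup_verts.
case: (j == ord_max) => A /=; last first.
  apply/setP => x; rewrite inE; apply/esym/imsetP => -[y].
  by rewrite inE.
have E l (B : {set 'I_l}) :
    [set x : 'I_l | [exists y in B, val y == val x]] = B.
  apply/setP => x; rewrite inE.
  apply/existsP/idP => [[y /andP[yB /eqP/val_inj<-]]//|xB].
  by exists x; rewrite eqxx andbT.
by rewrite !E.
Qed.

Lemma regular_trace_inj a : injective (@regular_trace a ord_max).
Proof.
(* Stated for a variable [j], so that the test inside the types can be destructed. *)
have E j (A : {set 'I_(blowup_verts a j)}) : j == ord_max ->
    forall x, (x \in A) = [exists y in regular_trace A, val y == val x].
  move: A; rewrite /regular_trace /blowup_verts.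
  case: (j == ord_max) => // A _ x; apply/idP/existsP => [xA|].
    exists x; rewrite inE eqxx andbT; apply/existsP; exists x.
    by rewrite eqxx andbT.
  move=> [y]; rewrite inE => /andP[/existsP[z /andP[zA /eqP zy]] /eqP yx].
  by rewrite (_ : x = z) //; apply: val_inj; rewrite zy yx.
by move=> A B AB; apply/setP => x; rewrite !E // AB.
Qed.

Lemma card_regular_trace a (A : {set 'I_(blowup_verts a ord_max)}) :
  #|regular_trace A| = #|A|.
Proof.
suff E j (B : {set 'I_(blowup_verts a j)}) : j == ord_max ->
  #|regular_trace B| = #|B| by exact: E.
move: B; rewrite /regular_trace /blowup_verts.
case: (j == ord_max) => // B _; apply: eq_card => x.
rewrite inE; apply/existsP/idP => [[y /andP[yB /eqP/val_inj<-]]//|].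
by exists x; rewrite eqxx andbT.
Qed.

Lemma regular_trace_lift a i (A : {set 'I_(blowup_verts a (lift ord_max i))}) :
  regular_trace A = set0.
Proof.
apply/setP => x; rewrite /regular_trace !inE eq_sym.
by rewrite (negPf (neq_lift _ _)).
Qed.

Lemma regular_traceT k j :
  regular_trace (val (top_multiface (n := n) k j)) = setT.
Proof.
rewrite /top_multiface /=.
apply/setP => x; rewrite /regular_trace !inE; move: x.
rewrite /blowup_verts /= /regular_verts.
case: (j == ord_max) => [x|[]//] /=.
by apply/existsP; exists x; rewrite inE eqxx.
Qed.

End ConeVertices.

(** * Naturality of the homotopy and of the projection *)

Section BlowUpHomotopy.
Variables (R : comPzRingType) (n : nat).
Implicit Types a b : filtered_simplex n.

Lemma htpy_coef_image m l (f : face_map m l) v (F : face m) :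
  htpy_coef R (f v) (face_image f F) = htpy_coef R v F.
Proof.
rewrite /htpy_coef /= face_sign_image.
by rewrite (mem_imset _ _ (@face_fun_inj _ _ f)).
Qed.

Lemma face_image_add_vertex m l (f : face_map m l) v (F : face m) :
  face_image f (add_vertex v F) = add_vertex (f v) (face_image f F).
Proof. by apply: val_inj; rewrite /= imsetU1. Qed.

Lemma face_image_vertex m l (f : face_map m l) v :
  face_image f (vertex_face v) = vertex_face (f v).
Proof. by apply: val_inj; rewrite /= imset_set1. Qed.

Lemma koszul_sign_blowup a b (f : filtered_map a b) F i :
  koszul_sign R (blowup_image f F) i = koszul_sign R F i.
Proof.
by congr (_ ^+ _); apply: eq_bigr => l _; rewrite /blowup_image face_image_dim.
Qed.

Lemma tensor_htpy_blowup a b (f : filtered_map a b) i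
    (w : multiface (blowup_verts b) -> R) F :
  tensor_htpy (cone_vertex b i) w (blowup_image f F) =
  tensor_htpy (cone_vertex a i) (w \o blowup_image f) F.
Proof.
rewrite /tensor_htpy koszul_sign_blowup !face_htpyE /=; congr (_ * _).
rewrite -(blowup_map_cone f) htpy_coef_image -face_image_add_vertex.
by rewrite blowup_image_dfwith.
Qed.

Lemma tensor_proj_blowup a b (f : filtered_map a b) i
    (w : multiface (blowup_verts b) -> R) F :
  tensor_proj (cone_vertex b i) w (blowup_image f F) =
  tensor_proj (cone_vertex a i) (w \o blowup_image f) F.
Proof.
rewrite /tensor_proj /= {1}/blowup_image face_image_dim blowup_image_dfwith.
by rewrite face_image_vertex blowup_map_cone.
Qed.

End BlowUpHomotopy.

(** * Degrees of the homotopy and of the projection *)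

Section TensorDegrees.
Variables (R : comPzRingType) (N : nat) (m : 'I_N -> nat).
Variables (i : 'I_N) (c : 'I_(m i)) (w : multiface m -> R).

Lemma multiface_dim_dfwith (F : multiface m) (G : face (m i)) :
  (multiface_dim (dfwith F G) + face_dim (F i) =
   multiface_dim F + face_dim G)%N.
Proof.
rewrite /multiface_dim (bigD1 i) //= [in RHS](bigD1 i) //= dfwith_in.
rewrite (eq_bigr (fun j => face_dim (F j))) => [|j ji].
  by rewrite addnC addnA addnAC.
by rewrite dfwith_out // eq_sym.
Qed.

(** Written with a successor rather than [k.-1], so that for [k = 0] it forces the homotopy to
    vanish. *)
Lemma tensor_htpy_homogeneous k :
    (forall F, w F != 0 -> multiface_dim F = k) ->
  forall F, tensor_htpy c w F != 0 -> (multiface_dim F).+1 = k.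
Proof.
move=> wk F; rewrite /tensor_htpy face_htpyE /htpy_coef.
case: ifPn => cF; first by rewrite mul0r mulr0 eqxx.
move=> nz; have wF : w (dfwith F (add_vertex c (F i))) != 0.
  by apply: contraNneq nz => ->; rewrite !mulr0.
have := multiface_dim_dfwith F (add_vertex c (F i)).
by rewrite (wk _ wF) add_vertex_dim // addnS -addSn => /addIn.
Qed.

Lemma tensor_proj_homogeneous k :
    (forall F, w F != 0 -> multiface_dim F = k) ->
  forall F, tensor_proj c w F != 0 -> multiface_dim F = k.
Proof.
move=> wk F; rewrite /tensor_proj.
case: ifP => [/eqP F0 wF|]; last by rewrite eqxx.
rewrite -(wk _ wF); have := multiface_dim_dfwith F (vertex_face c).
by rewrite F0 /face_dim /= cards1 !addn0.
Qed.

End TensorDegrees.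

Lemma tensor_diffD (R : comPzRingType) N (m : 'I_N -> nat)
    (w w' : multiface m -> R) F :
  tensor_diff (fun G => w G + w' G) F = tensor_diff w F + tensor_diff w' F.
Proof.
rewrite /tensor_diff -big_split /=; apply: eq_bigr => i _; rewrite -mulrDr.
congr (_ * _); rewrite /simplex_diff -big_split /=.
by apply: eq_bigr => G _; rewrite -mulrDr.
Qed.

(** * Projections of the Thom-Whitney complex *)

Section ThomWhitneyHomotopy.
Variables (R : comPzRingType) (n : nat) (K : filtered_face_set n).
Implicit Types (w : tw_index K -> R^o) (i : 'I_n) (s : seq 'I_n).

(** Defined on arbitrary families, so that the homotopy identities involve no degrees. *)
Definition tw_htpy i w : tw_index K -> R^o := fun x =>
  tensor_htpy (cone_vertex (plus_shape (projT1 x)) i)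
    (tw_component w (projT1 x)) (projT2 x).

Definition tw_proj i w : tw_index K -> R^o := fun x =>
  tensor_proj (cone_vertex (plus_shape (projT1 x)) i)
    (tw_component w (projT1 x)) (projT2 x).

Lemma tw_htpy_mem i k w : w \in tw_mem k.+1 -> tw_htpy i w \in tw_mem k.
Proof.
move=> /asboolP[wk wn]; apply/asboolP; split=> [s F nz|s a a_gt0 f F].
  exact/succn_inj/(tensor_htpy_homogeneous (@wk s) nz).
rewrite /tw_component /tw_htpy /= tensor_htpy_blowup.
by congr (tensor_htpy _ _ _); apply/funext => G; exact: wn.
Qed.

Lemma tw_proj_mem i k w : w \in tw_mem k -> tw_proj i w \in tw_mem k.
Proof.
move=> /asboolP[wk wn]; apply/asboolP; split=> [s F nz|s a a_gt0 f F].
  exact: tensor_proj_homogeneous (@wk s) _ nz.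
rewrite /tw_component /tw_proj /= tensor_proj_blowup.
by congr (tensor_proj _ _ _); apply/funext => G; exact: wn.
Qed.

Lemma tw_htpyP i w :
  tw_diff_family (tw_htpy i w) + tw_htpy i (tw_diff_family w) = w - tw_proj i w.
Proof. by apply/funext => -[s F]; 
exact: (tensor_htpyP (cone_vertex _ i) (tw_component w s) F). Qed.

Lemma tw_htpy_degree0 i w : w \in tw_mem 0 -> tw_htpy i w = 0.
Proof.
move=> /asboolP[wk _]; apply/funext => -[s F]; apply/eqP/negPn/negP.
by move/(tensor_htpy_homogeneous (@wk s)).
Qed.

Lemma tw_diff_familyD w w' :
  tw_diff_family (w + w') = tw_diff_family w + tw_diff_family w'.
Proof.
by apply/funext => -[s F]; exact: tensor_diffD.
Qed.

Lemma tw_diff_family0 : tw_diff_family (0 : tw_index K -> R^o) = 0.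
Proof.
by apply/(@addIr _ (tw_diff_family 0)); rewrite -tw_diff_familyD !add0r.
Qed.

Lemma tw_diff_family_diff w : tw_diff_family (tw_diff_family w) = 0.
Proof.
by apply/funext => -[s F]; exact: (tensor_diff_diff (tw_component w s) F).
Qed.

Lemma tw_htpy0 i : tw_htpy i (0 : tw_index K -> R^o) = 0.
Proof.
apply/funext => -[s F]; rewrite /tw_htpy /tensor_htpy face_htpyE.
by rewrite /tw_component !mulr0.
Qed.

(** Writing the projection as the identity minus [d h + h d], both sides become [d w - d h d w]
    since [d d = 0]. *)
Lemma tw_diff_proj i w :
  tw_diff_family (tw_proj i w) = tw_proj i (tw_diff_family w).
Proof.
have e v : tw_proj i v = v - (tw_diff_family (tw_htpy i v) +
    tw_htpy i (tw_diff_family v)) by rewrite tw_htpyP opprB addrC subrK.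
have DN v : tw_diff_family (- v) = - tw_diff_family v :> (tw_index K -> R^o).
  apply: (@addIr _ (tw_diff_family v)).
  by rewrite -tw_diff_familyD !addNr tw_diff_family0.
rewrite !e tw_diff_familyD DN tw_diff_familyD !tw_diff_family_diff.
by rewrite tw_htpy0 add0r addr0.
Qed.

Definition tw_projs s w := foldr tw_proj w s.

Lemma tw_projs_mem s k w : w \in tw_mem k -> tw_projs s w \in tw_mem k.
Proof. by move=> wk; elim: s => //= i s; exact: tw_proj_mem. Qed.

Lemma tw_diff_projs s w :
  tw_diff_family (tw_projs s w) = tw_projs s (tw_diff_family w).
Proof. by elim: s => //= i s IHs; rewrite tw_diff_proj IHs. Qed.

(** A left fold, because evaluating the outermost projection of [tw_projs] replaces its factor
    first. *)
Definition cone_multiface a (F : multiface (blowup_verts a)) s :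
    multiface (blowup_verts a) :=
  foldl (fun (G : multiface (blowup_verts a)) i =>
    dfwith G (vertex_face (cone_vertex a i))) F s.

Lemma cone_multiface_lift a (F : multiface (blowup_verts a)) s i :
    i \in s ->
  cone_multiface F s (lift ord_max i) = vertex_face (cone_vertex a i).
Proof.
elim/last_ind: s => // s j IHs; rewrite mem_rcons inE /cone_multiface.
rewrite foldl_rcons; have [<- _|ij /= /IHs] := eqVneq i j.
  by rewrite dfwith_in.
by rewrite dfwith_out // (inj_eq lift_inj) eq_sym.
Qed.

Lemma cone_multiface_max a (F : multiface (blowup_verts a)) s :
  cone_multiface F s ord_max = F ord_max.
Proof.
elim/last_ind: s => // s j IHs; rewrite /cone_multiface foldl_rcons.
by rewrite dfwith_out // eq_sym neq_lift.
Qed.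

Lemma tw_projsE s w (x : plus_simplex K) F :
  tw_component (tw_projs s w) x F =
  if all (fun i => face_dim (F (lift ord_max i)) == 0%N) s
  then tw_component w x (cone_multiface F s) else 0.
Proof.
elim: s F => //= i s IHs F; rewrite {1}/tw_component /tw_proj /tensor_proj /=.
case: eqP => //= F0; rewrite IHs; congr (if _ then _ else _).
(* Replacing factor [i] by its cone point leaves the tests unchanged, since both faces have
   dimension 0. *)
apply: eq_all => j /=; congr (_ == _).
have [ij|ij] := eqVneq i j; last by rewrite dfwith_out // (inj_eq lift_inj).
by subst j; rewrite dfwith_in F0 /face_dim /= cards1.
Qed.

(** For a cocycle the homotopy identity reads [w - tw_proj i w = d (h w)]. In degree 0 the only
    coboundary is 0, and there [h w] vanishes. *)
Lemma tw_proj_coboundary i k (w u : tw_cochain R K k) :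
    tw_diff_family w = 0 -> tw_family u = tw_family w - tw_proj i w ->
  is_coboundary (C := tw_complex R K) (k := k) u.
Proof.
move=> dw; rewrite -tw_htpyP dw tw_htpy0 addr0.
case: k w dw u => [|k] w dw u uE.
  apply: val_inj; rewrite /= uE tw_htpy_degree0 ?tw_diff_family0 //.
  exact: tw_familyP.
exists (TWCochain (tw_htpy_mem i (tw_familyP w))).
exact: val_inj.
Qed.

(** The difference telescopes over [s]; every intermediate family is a cocycle because the
    projections commute with the differential. *)
Lemma tw_projs_coboundary s k (w u : tw_cochain R K k) :
    tw_diff_family w = 0 -> tw_family u = tw_family w - tw_projs s w ->
  is_coboundary (C := tw_complex R K) (k := k) u.
Proof.
elim: s u => [|i s IHs] u dw uE.
  have -> : u = 0 by apply: val_inj; rewrite /= uE subrr.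
  case: k {w u dw uE} => [//|k]; exists 0; exact/esym/linear0.
pose v : tw_cochain R K k := TWCochain (tw_projs_mem s (tw_familyP w)).
pose v' : tw_cochain R K k := TWCochain (tw_proj_mem i (tw_familyP v)).
have dv : tw_diff_family v = 0.
  rewrite /= tw_diff_projs dw; elim: (s) => //= j t ->.
  by apply/funext => -[x F]; rewrite /tw_proj /tensor_proj; case: ifP.
have -> : u = 1 *: (w - v) + (v - v').
  by apply: val_inj; rewrite scale1r /= uE addrA subrK.
apply: is_coboundaryP; first exact: IHs.
exact: (tw_proj_coboundary dv).
Qed.

End ThomWhitneyHomotopy.

(** * The section of the restriction *)

Section RegularExtension.
Variables (R : comPzRingType) (n : nat) (K : filtered_face_set n) (k : nat).

(** Amounts to the last factor having dimension [k], but as an equation for every factor it is what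
    [face_incl] takes as argument. *)
Definition regular_shape a (F : multiface (blowup_verts a)) : Prop :=
  forall j : 'I_n.+1, #|regular_trace (val (F j))| = regular_verts k j.

Definition regular_incl a (F : multiface (blowup_verts a))
    (e : regular_shape F) : filtered_map (regular_simplex n k) a :=
  fun j => face_incl (e j).

Lemma regular_shapeP a (F : multiface (blowup_verts a)) :
  regular_shape F <-> face_dim (F ord_max) = k.
Proof.
split=> [/(_ ord_max)|Fk j].
  by rewrite card_regular_trace /regular_verts eqxx /face_dim => ->.
have [i ->|->] := unliftP ord_max j.
  rewrite regular_trace_lift cards0 /regular_verts eq_sym.
  by rewrite (negPf (neq_lift _ _)).
rewrite card_regular_trace /regular_verts eqxx -Fk /face_dim prednK //.
by rewrite card_gt0 (valP (F ord_max)).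
Qed.

Lemma filtered_map_image_inj (a b : filtered_simplex n)
    (f g : filtered_map a b) :
  (forall j, f j @: setT = g j @: setT) -> f = g.
Proof.
move=> fg; apply: functional_extensionality_dep => j.
exact/face_map_image_inj/fg.
Qed.

(** For [i < n] the only vertex of the cone on the empty simplex goes to the cone point; on the last
    factor the map enumerates the vertices of [F]. *)
Lemma regular_incl_image a (F : multiface (blowup_verts a))
    (e : regular_shape F) :
  blowup_image (regular_incl e) (top_multiface k) =
  cone_multiface F (enum 'I_n).
Proof.
apply: functional_extensionality_dep => j; apply: val_inj.
have [i ->|->] := unliftP ord_max j.
  rewrite cone_multiface_lift ?mem_enum //.
  rewrite -(blowup_map_cone (regular_incl e)) -face_image_vertex.
  congr (val (face_image _ _)); apply: val_inj => /=.
  apply/setP => x; rewrite !inE; apply/esym/eqP/val_inj => /=.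
  have := ltn_ord x.
  rewrite {2}/blowup_verts /regular_simplex /= /regular_verts.
  by rewrite eq_sym (negPf (neq_lift _ _)) ltnS leqn0 => /eqP.
apply: regular_trace_inj; rewrite cone_multiface_max /blowup_image /=.
by rewrite regular_trace_image regular_traceT face_incl_image.
Qed.

(** The tensor product of the constant cochains 1 on the cones with [c] on the last factor. *)
Definition regular_ext_family (c : regular_part K k -> R^o) :
    tw_index K -> R^o := fun x =>
  if pselect (regular_shape (projT2 x)) is left e then
    if [forall i : 'I_n, face_dim (projT2 x (lift ord_max i)) == 0%N] then
      c (pull (regular_incl e) (plus_val (projT1 x))) else 0
  else 0.

Lemma regular_ext_mem c : regular_ext_family c \in tw_mem k.
Proof.
apply/asboolP; split=> [s F|s a a_gt0 f F];
  rewrite /tw_component /regular_ext_family /=.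
  case: pselect => [e|]; last by rewrite eqxx.
  have Fk : face_dim (F ord_max) = k by exact/regular_shapeP.
  case: ifP => [/forallP F0 _|]; last by rewrite eqxx.
  rewrite /multiface_dim (bigD1_ord ord_max) //= Fk big1 ?addn0 // => i _.
  exact/eqP/F0.
have dimE j : face_dim (blowup_image f F j) = face_dim (F j).
  exact: face_image_dim.
under [in RHS]eq_forallb do rewrite dimE.
case: pselect => e; case: pselect => e' //.
(* The inclusion of the image of [F] and [f] after the inclusion of [F] have the same image, hence
   are equal. *)
- rewrite -pull_comp; congr (if _ then c (pull _ _) else _).
  apply: filtered_map_image_inj => j.
  rewrite face_incl_image regular_trace_image.
  by rewrite -(face_incl_image (e j)) -imset_comp.
- by case: e'; apply/regular_shapeP; rewrite dimE; exact/regular_shapeP.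
- by case: e; apply/regular_shapeP; rewrite -dimE; exact/regular_shapeP.
Qed.

Definition regular_ext (c : fs_cochains R (regular_part K) k) :
  tw_cochain R K k := TWCochain (regular_ext_mem c).

Lemma restriction_ext c : restriction_fun (regular_ext c) = c.
Proof.
apply/funext => s.
rewrite /restriction_fun /tw_component /= /regular_ext_family /=.
case: pselect => [e|[]]; last first.
  apply/regular_shapeP; rewrite /face_dim /= cardsT card_ord.
  by rewrite /blowup_verts /= /regular_verts eqxx.
case: ifPn => [_|/negP[]]; last first.
  by apply/forallP => i; rewrite top_multiface_dim // eq_sym neq_lift.
(* The top multiface spans the whole simplex, so its inclusion has full image. *)
rewrite (_ : regular_incl e = filtered_id _) ?pull_id //.
apply: filtered_map_image_inj => j; rewrite face_incl_image regular_traceT.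
by apply/setP => x; rewrite inE; apply/esym/imsetP; exists x.
Qed.

Lemma tw_projs_restriction (w : tw_cochain R K k) :
  tw_projs (enum 'I_n) w = regular_ext (restriction_fun w).
Proof.
apply/funext => -[s F]; have := @tw_projsE _ _ _ (enum 'I_n) w s F.
rewrite {1}/tw_component => -> /=; rewrite /regular_ext_family /=.
have -> : all (fun i => face_dim (F (lift ord_max i)) == 0%N) (enum 'I_n) =
    [forall i, face_dim (F (lift ord_max i)) == 0%N].
  by apply/allP/forallP => [F0 i|F0 i _]; apply: F0; rewrite ?mem_enum.
have /asboolP[wk wn] := tw_familyP w.
case: pselect => [e|nFk]; case: ifP => // _.
  (* Naturality of [w] along [regular_incl e] moves the evaluation to a simplex of the regular
     part. *)
  rewrite /restriction_fun -(regular_incl_image e).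
  by rewrite -(wn s _ (regular_shape_gt0 n k)).
(* Cone points have dimension 0, so a nonzero value would force the last factor to have dimension
   [k]. *)
apply/eqP/negPn/negP => /wk Fk; apply: nFk; apply/regular_shapeP.
rewrite -Fk /multiface_dim (bigD1_ord ord_max) //= cone_multiface_max.
rewrite big1 ?addn0 // => i _; rewrite cone_multiface_lift ?mem_enum //.
by rewrite /face_dim /= cards1.
Qed.

Fact regular_ext_linear : linear regular_ext.
Proof.
move=> a c c'; apply: val_inj; apply/funext => -[s F].
rewrite /= !fctE /regular_ext_family /=.
by case: pselect => e; [case: ifP => // _|]; rewrite scaler0 addr0.
Qed.

HB.instance Definition _ :=
  GRing.isLinear.Build R (fs_cochains R (regular_part K) k) (tw_cochain R K k) _
    regular_ext regular_ext_linear.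

End RegularExtension.

(** Let P be the product of the projections, E the extension and r the restriction. Then P = E r and
    r E = 1, so d E = d P E = P d E = E r d E = E d r E = E d. *)
Lemma regular_ext_diff (R : comPzRingType) n (K : filtered_face_set n) k
    (c : fs_cochains R (regular_part K) k) :
  tw_diff (regular_ext c) =
  regular_ext (diff (fs_cochains R (regular_part K)) k c).
Proof.
apply: val_inj => /=.
have e : regular_ext c = tw_projs (enum 'I_n) (regular_ext c) :> (_ -> R^o).
  by rewrite tw_projs_restriction restriction_ext.
transitivity (tw_diff_family (tw_projs (enum 'I_n) (regular_ext c))).
  by rewrite -e.
have := tw_projs_restriction (tw_diff (regular_ext c)).
by rewrite restriction_diff restriction_ext tw_diff_projs.
Qed.

Definition regular_extension (R : comPzRingType) n (K : filtered_face_set n) :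
    chain_map (fs_cochains R (regular_part K)) (tw_complex R K) :=
  @ChainMap R (fs_cochains R (regular_part K)) (tw_complex R K)
    (fun k => @regular_ext R n K k) (fun k c => esym (regular_ext_diff c)).

(* The map induced in cohomology by the restriction chain map is an isomorphism
   of R-modules in every degree k. *)
Theorem proposition1p54 (n : nat) (R : comPzRingType)
    (K : filtered_face_set n) (k : nat) :
  bijective (cohomology_map (restriction R K) (k := k) :
    {linear cohomology (tw_complex R K) k ->
            cohomology (fs_cochains R (regular_part K)) k}).
Proof.
exists (cohomology_map (regular_extension R K) (k := k)) => x /=;
  rewrite -[x]cohomology_class_repr !cohomology_map_class.
  (* Extending the restriction of [z] gives its image under all projections, which is cohomologous
     to [z]. *)
  set z := repr _; apply/esym/cohomology_classP.
  have dz : tw_diff_family (cocycle_val z) = 0.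
    exact: (congr1 val (eqP (cocycleP z))).
  apply: (tw_projs_coboundary (s := enum 'I_n) dz).
  by rewrite tw_projs_restriction.
(* The other composite is the identity already on cochains. *)
by congr cohomology_class; apply: val_inj; exact: restriction_ext.
Qed.
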